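(* Each of the following implications is valid, and in each case the reverse implication is not valid: 1. ${\sim}\neg\neg p\rightarrow{\sim}p$; 2. ${\sim}p\rightarrow\neg\neg{\sim}p$; 3. $\neg\neg{\sim}p\rightarrow\neg{\sim}{\sim}p$; 4. $\neg{\sim}{\sim}p\rightarrow\neg p$; 5. $\neg p\rightarrow{\sim}{\sim}\neg p$; 6. ${\sim}\neg\neg p\rightarrow\neg{\sim}{\sim}\neg\neg p$; 7. $\neg{\sim}{\sim}\neg\neg p\rightarrow\neg\neg{\sim}p$.
   Context: Fix one propositional variable $p$. The n-formulae (monadic purely negational fragment of Intuitionistic Control Logic) are the formulae built from $p$ using only two primitive unary connectives ${\sim}$ (intuitionistic negation) and $\neg$ ($\perp$-negation). A Kripke r-model is $\langle W,\mathbf r,\leq,\Vdash\rangle$ where $W$ is a finite non-empty set (of worlds), $\leq$ is a reflexive and transitive relation on $W$, $\mathbf r\in W$ (the root) is the least element ($\mathbf r\leq u$ for all $u\in W$), and $\Vdash$ is a forcing relation between worlds and $p$ that is monotone: $u\leq v$ and $u\Vdash p$ imply $v\Vdash p$. We write $w>\mathbf r$ when $w$ is a world properly above the root, i.e. a world other than the root. Forcing is extended to n-formulae by: $u\Vdash {\sim}A$ iff for all $w\geq u$, $w\not\Vdash A$; $u\Vdash \neg A$ iff for all $w\geq u$, $w\not\Vdash A$ or $w>\mathbf r$. For n-formulae $A,B$: $u\Vdash A\rightarrow B$ iff for all $v\geq u$, $v\Vdash A$ implies $v\Vdash B$. A formula is valid if it is forced at every world of every r-model. *)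

(* Defs.v *)
From mathcomp Require Import all_boot.

Set Implicit Arguments.
Unset Strict Implicit.
Unset Printing Implicit Defensive.

(* n-formulae over the single propositional variable p; [ineg] is the
   intuitionistic negation (~) and [bneg] the bottom-negation. *)
Inductive nform : Type :=
  | p
  | ineg of nform
  | bneg of nform.

(* [le] is only a preorder, not assumed antisymmetric. *)
Record rmodel : Type := RModel {
  world :> finType;
  root : world;
  le : rel world;
  forces_p : pred world;
  le_refl : reflexive le;
  le_trans : transitive le;
  root_least : forall u, le root u;
  forces_p_mono : forall u v, le u v -> forces_p u -> forces_p v
}.

(* w > r: as root is least, this just means that w differs from root, even
   when w happens to be equivalent to root in the preorder. *)
Definition above_root (M : rmodel) (w : M) : Prop := w <> root M.

Fixpoint forces (M : rmodel) (u : M) (A : nform) : Prop :=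
  match A with
  | p => forces_p u
  | ineg B => forall w : M, le u w -> ~ forces w B
  | bneg B => forall w : M, le u w -> ~ forces w B \/ above_root w
  end.

(* An implication A -> B between n-formulae is not itself an n-formula, so its
   forcing and validity are defined separately. *)
Definition forces_imp (M : rmodel) (u : M) (A B : nform) : Prop :=
  forall v : M, le u v -> forces v A -> forces v B.

Definition valid_imp (A B : nform) : Prop :=
  forall (M : rmodel) (u : M), forces_imp u A B.

Definition strict_imp (A B : nform) : Prop :=
  valid_imp A B /\ ~ valid_imp B A.

(* Main.v *)
Require Import Defs.
From mathcomp Require Import all_boot.

(** Two observations carry the proof.

    First, the clause for the bottom-negation only ever inspects the root: a
    world [u] forces [bneg A] iff either the root is not accessible from [u] or
    the root does not force [A] ([forces_bneg]).  Since forcing is persistent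
    ([forces_mono]), the worlds from which the root is accessible force the same
    formulae as the root, whereas every other world forces all formulae
    [bneg A].  Each implication then becomes a short argument about the root.
    The only delicate one is the last.  If a world [w] forces
    [ineg (bneg (bneg p))], then the root is accessible from [w] (otherwise [w]
    would force [bneg (bneg p)]), so [w] may be exchanged for the root, and the
    first implication puts [ineg p] at the root.  Contrapositively, a root that
    does not force [ineg p] forces [ineg (ineg (bneg (bneg p)))].

    Second, all converses fail on one frame, a root below two incomparable
    leaves, where forcing is decided by a boolean recursion ([fork_forcesP]); a
    suitable valuation and world then refute each converse by computation
    ([fork_refutes]).  The second leaf is needed only to separate
    [bneg (ineg (ineg p))] from [bneg (bneg (ineg p))], since this takes a root
    that sees both a world forbidding [p] for ever and a world forcing [p]. *)

Set Implicit Arguments.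
Unset Strict Implicit.
Unset Printing Implicit Defensive.

(** * Forcing and the root *)

Section Forcing.
Variable M : rmodel.
Implicit Types (u v w : M) (A : nform).

Lemma forces_mono u v A : le u v -> forces u A -> forces v A.
Proof.
case: A => [|A|A] /= uv; first exact: forces_p_mono uv.
- by move=> uA w vw; apply: uA; apply: le_trans uv vw.
- by move=> uA w vw; apply: uA; apply: le_trans uv vw.
Qed.

(** The only world that does not lie properly above the root is the root
    itself, so the quantifier over successors collapses to that single world. *)
Lemma forces_bneg u A :
  forces u (bneg A) <-> (le u (Defs.root M) -> ~ forces (Defs.root M) A).
Proof.
split=> [uA ur rA | uA w uw].
  by case: (uA _ ur) => [/(_ rA) | /(_ erefl)].
have [wr|/eqP nwr] := eqVneq w (Defs.root M); last by right.
by left; rewrite wr; apply: uA; rewrite -wr.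
Qed.

Lemma forces_bneg_bneg u A :
  forces u (bneg (bneg A)) <->
  (le u (Defs.root M) -> ~ ~ forces (Defs.root M) A).
Proof.
split=> [/forces_bneg uA ur nrA | uA].
  by apply: (uA ur); apply/forces_bneg.
apply/forces_bneg => ur /forces_bneg nrA.
by apply: (uA ur); apply: nrA; apply: le_refl.
Qed.

Lemma ineg_bneg_bneg_le_root u A :
  forces u (ineg (bneg (bneg A))) -> le u (Defs.root M).
Proof.
move=> uA; have [//|/negP nur] := boolP (le u (Defs.root M)).
by case: (uA u (le_refl u)); apply/forces_bneg_bneg.
Qed.

End Forcing.

(** * The valid implications *)

Lemma ineg_bneg_bneg_imp_ineg A :
  valid_imp (ineg (bneg (bneg A))) (ineg A).
Proof.
move=> M u v _ vA w vw wA; apply: (vA w vw).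
by apply/forces_bneg_bneg => wr; apply; apply: forces_mono wA.
Qed.

Lemma imp_bneg_bneg A : valid_imp A (bneg (bneg A)).
Proof.
move=> M u v _ vA; apply/forces_bneg_bneg => vr; apply.
exact: forces_mono vA.
Qed.

Lemma imp_ineg_ineg A : valid_imp A (ineg (ineg A)).
Proof.
by move=> M u v _ vA w vw /(_ w (le_refl w)); apply; apply: forces_mono vA.
Qed.

Lemma bneg_contra A B : valid_imp A B -> valid_imp (bneg B) (bneg A).
Proof.
move=> AB M u v _ /forces_bneg vB; apply/forces_bneg => vr rA.
by apply: vB => //; apply: AB rA; apply: le_refl.
Qed.

Lemma valid_imp_trans A B C : valid_imp A B -> valid_imp B C -> valid_imp A C.
Proof. by move=> AB BC M u v uv /(AB M u v uv); apply: BC uv. Qed.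

Lemma ineg_imp_bneg A : valid_imp (ineg A) (bneg A).
Proof. by move=> M u v _ vA w /vA; left. Qed.

Lemma bneg_bneg_ineg_imp A :
  valid_imp (bneg (bneg (ineg A))) (bneg (ineg (ineg A))).
Proof. exact: (@bneg_contra _ _ (@ineg_imp_bneg (ineg A))). Qed.

Lemma ineg_imp_bneg_ineg_ineg A : valid_imp (ineg A) (bneg (ineg (ineg A))).
Proof.
exact: (@valid_imp_trans _ _ _
         (@imp_bneg_bneg (ineg A)) (@bneg_bneg_ineg_imp A)).
Qed.

(** It is enough that a root not forcing [ineg A] forces
    [ineg (ineg (bneg (bneg A)))]: a world [w] forcing
    [ineg (bneg (bneg A))] forces [ineg A] and sees the root, hence would carry
    [ineg A] down to it. *)
Lemma bneg_ineg_ineg_bneg_bneg_imp A :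
  valid_imp (bneg (ineg (ineg (bneg (bneg A))))) (bneg (bneg (ineg A))).
Proof.
move=> M u v _ /forces_bneg vA; apply/forces_bneg_bneg => vr nrA.
apply: (vA vr) => w _ wA; apply: nrA.
apply: forces_mono (ineg_bneg_bneg_le_root wA) _.
exact: ineg_bneg_bneg_imp_ineg (le_refl w) wA.
Qed.

(** * Refutations on a fork *)

Section Fork.
Variables (atRoot : bool) (atLeaf : pred bool).

(** The root is [None] and the leaves are [Some b].  Forcing [p] at the leaves
    whenever it holds at the root makes every choice of [atRoot] and [atLeaf] a
    monotone valuation. *)
Definition fork_le (x y : option bool) := (x == None) || (x == y).

Definition fork_p (x : option bool) :=
  if x is Some b then atRoot || atLeaf b else atRoot.

Lemma fork_le_refl : reflexive fork_le.
Proof. by move=> x; rewrite /fork_le eqxx orbT. Qed.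

Lemma fork_le_trans : transitive fork_le.
Proof. by move=> [b|] [a|] [c|] //; rewrite /fork_le /= => /eqP->. Qed.

Lemma fork_root_least x : fork_le None x.
Proof. by []. Qed.

Lemma fork_p_mono x y : fork_le x y -> fork_p x -> fork_p y.
Proof.
by case: x y => [a|] [b|] //=; [move/eqP=> [->] | move=> _ ->].
Qed.

Definition fork : rmodel :=
  RModel fork_le_refl fork_le_trans fork_root_least fork_p_mono.

Fixpoint fork_forces (x : option bool) (A : nform) : bool :=
  match A, x with
  | p, _ => fork_p x
  | ineg B, Some _ => ~~ fork_forces x B
  | ineg B, None => [&& ~~ fork_forces None B,
                        ~~ fork_forces (Some true) B
                      & ~~ fork_forces (Some false) B]
  | bneg B, Some _ => true
  | bneg B, None => ~~ fork_forces None B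
  end.

Lemma fork_forcesP (x : fork) A : reflect (forces x A) (fork_forces x A).
Proof.
elim: A x => [|A IH|A IH] x; first exact: idP.
- case: x => [b|] /=; apply: (iffP idP).
  + by move=> /IH nA [c|] // /eqP [<-].
  + by move=> nA; apply/IH; apply: nA; apply: fork_le_refl.
  + by case/and3P=> /IH nN /IH nT /IH nF [[]|].
  + by move=> nA; apply/and3P; split; apply/IH; apply: nA.
- apply: (equivP _ (iff_sym (forces_bneg _ _))).
  case: x => [b|] /=; first by left.
  by apply: (iffP idP) => [/IH nA _ | nA]; last by apply/IH; apply: nA.
Qed.

Lemma fork_refutes x A B :
  fork_forces x A -> ~~ fork_forces x B -> ~ valid_imp A B.
Proof.
move=> /fork_forcesP xA /fork_forcesP nB AB; apply: nB.
exact: AB (@le_refl fork x) xA.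
Qed.

End Fork.

Theorem theorem21 :
  strict_imp (ineg (bneg (bneg p))) (ineg p) /\
  strict_imp (ineg p) (bneg (bneg (ineg p))) /\
  strict_imp (bneg (bneg (ineg p))) (bneg (ineg (ineg p))) /\
  strict_imp (bneg (ineg (ineg p))) (bneg p) /\
  strict_imp (bneg p) (ineg (ineg (bneg p))) /\
  strict_imp (ineg (bneg (bneg p))) (bneg (ineg (ineg (bneg (bneg p))))) /\
  strict_imp (bneg (ineg (ineg (bneg (bneg p))))) (bneg (bneg (ineg p))).
Proof.
do 7?split.
- exact: ineg_bneg_bneg_imp_ineg.
- exact: (@fork_refutes false pred0 None).
- exact: imp_bneg_bneg.
- (* A leaf forces every bottom-negation, even where [p] holds. *)
  exact: (@fork_refutes false predT (Some true)).
- exact: bneg_bneg_ineg_imp.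
- (* With [p] at just one leaf, the root forces neither [ineg p] nor
     [ineg (ineg p)]. *)
  exact: (@fork_refutes false id None).
- exact: (@bneg_contra _ _ (@imp_ineg_ineg p)).
- exact: (@fork_refutes false predT None).
- exact: imp_ineg_ineg.
- (* With [p] everywhere, [bneg p] holds at the leaves but not at the root. *)
  exact: (@fork_refutes true predT None).
- exact: ineg_imp_bneg_ineg_ineg.
- exact: (@fork_refutes false pred0 (Some true)).
- exact: bneg_ineg_ineg_bneg_bneg_imp.
- exact: (@fork_refutes false pred0 None).
Qed.
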